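(* There exist $J_0\in\mathbb R$ and, for each $J\ge J_0$, a constant $C_8=C_8(J,c,r)>0$ such that for all $J\ge J_0$, all $L$ and all $i,j\in\Lambda_L$, $$\langle h_ih_j\rangle^J_{\Lambda_L}\le\frac1{C_8}e^{-C_8\|j-i\|_1}.$$
   Context: Fix an integer $r\ge1$. For each $k\in\mathbb Z^2$ let $\Psi_k:\mathbb R\to\mathbb R$ satisfy: $\Psi_k\equiv0$ if $\|k\|_1>r$; $\Psi_k=\Psi_{-k}$ and $\Psi_k(x)=\Psi_k(-x)$; $\Psi_k$ is $C^2$; $\Psi_k''\ge0$, and there is $c>0$ such that the translation-invariant random walk on $\mathbb Z^2$ with jump rates $P_c(0,j)=1$ if $\Psi_j''(h)\ge c$ for all $h$ and $0$ otherwise is irreducible. Let $\Lambda_L=[-L,L]^2\cap\mathbb Z^2$. For $J\in\mathbb R$, $$\mu^J_{\Lambda_L}(d\underline h)=\frac1{Z^J_{\Lambda_L}}\exp\Big[-\sum_{\langle ij\rangle\subset\Lambda_L}\Psi_{j-i}(h_i-h_j)-\sum_{\langle ij\rangle:\,i\in\Lambda_L,\,j\notin\Lambda_L}\Psi_{j-i}(h_i)\Big]\prod_{i\in\Lambda_L}\big(dh_i+e^J\delta_0(dh_i)\big),$$ with $\langle ij\rangle$ ranging over pairs of distinct sites with $\|j-i\|_\infty\le r$; $\langle\cdot\rangle^J_{\Lambda_L}$ is expectation under this measure. *)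

(* Defs.v *)
From HB Require Import structures.
From mathcomp Require Import all_boot all_order all_algebra.
From mathcomp Require Import all_classical all_reals all_analysis.
Set Implicit Arguments. Unset Strict Implicit. Unset Printing Implicit Defensive.
Import Order.TTheory GRing.Theory Num.Theory.
Import numFieldNormedType.Exports.
Local Open Scope ring_scope.

Definition site := (int * int)%type.
Definition sadd (a b : site) : site := (a.1 + b.1, a.2 + b.2).
Definition ssub (a b : site) : site := (a.1 - b.1, a.2 - b.2).
Definition sopp (a : site) : site := (- a.1, - a.2).
Definition norm1 (k : site) : nat := (`|k.1| + `|k.2|)%N.
Definition normoo (k : site) : nat := maxn `|k.1| `|k.2|.

Definition irange (M : nat) : seq int := [seq (k%:Z - M%:Z) | k <- iota 0 (2 * M).+1].
Definition box (M : nat) : seq site := [seq (a, b) | a <- irange M, b <- irange M].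
Definition inLambda (L : nat) (i : site) : Prop :=
  (`|i.1| <= L)%N /\ (`|i.2| <= L)%N.

(* strict lexicographic order on sites, used to enumerate unordered pairs once *)
Definition slt (i j : site) : bool := (i.1 < j.1) || ((i.1 == j.1) && (i.2 < j.2)).

Section Model.
Variable R : realType.

Definition C2 (f : R -> R) : Prop :=
  (forall x, derivable f x 1) /\ (forall x, derivable (derive1 f) x 1) /\
  continuous (derive1n 2 f).

Inductive reach (S : site -> Prop) : site -> site -> Prop :=
| reach_refl x : reach S x x
| reach_step x y z : S (ssub y x) -> reach S y z -> reach S x z.

Definition irreducible (S : site -> Prop) : Prop := forall x y, reach S x y.

Definition admissible (r : nat) (c : R) (Psi : site -> R -> R) : Prop :=
  (forall k, (r < norm1 k)%N -> forall x, Psi k x = 0) /\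
      (forall k x, Psi k x = Psi (sopp k) x) /\
      (forall k x, Psi k x = Psi k (- x)) /\
      (forall k, C2 (Psi k)) /\
      (forall k x, 0 <= derive1n 2 (Psi k) x) /\
      irreducible (fun j => forall h, c <= derive1n 2 (Psi j) h).

(* Hamiltonian on Lambda_L with zero boundary condition *)
Definition hamiltonian (r L : nat) (Psi : site -> R -> R) (h : site -> R) : R :=
  \sum_(i <- box L) \sum_(j <- box L | slt i j && (normoo (ssub j i) <= r)%N)
     Psi (ssub j i) (h i - h j)
  + \sum_(i <- box L) \sum_(j <- box (L + r) | (j \notin box L) && (normoo (ssub j i) <= r)%N)
     Psi (ssub j i) (h i).

Definition expJ_nng (J : R) : {nonneg R} := NngNum (ltW (expR_gt0 J)).

Definition single_site (J : R) :=
  @measure_add _ (measurableTypeR R) R lebesgue_measure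
    (mscale (expJ_nng J) (@dirac _ (measurableTypeR R) (0 : R) R)).

Definition upd (h : site -> R) (s : site) (x : R) : site -> R :=
  fun t => if t == s then x else h t.

Fixpoint iint (J : R) (ss : seq site) (f : (site -> R) -> R) (h : site -> R) : \bar R :=
  match ss with
  | [::] => (f h)%:E
  | s :: ss' => (\int[single_site J]_x iint J ss' f (upd h s x))%E
  end.

(* integral with respect to prod_{i in Lambda_L} (dh_i + e^J delta_0(dh_i)),
   with h_j = 0 outside Lambda_L *)
Definition integral_Lambda (J : R) (L : nat) (f : (site -> R) -> R) : \bar R :=
  iint J (box L) f (fun _ => 0).

Definition partition_fn (r : nat) (Psi : site -> R -> R) (J : R) (L : nat) : \bar R :=
  integral_Lambda J L (fun h => expR (- hamiltonian r L Psi h)).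

Definition corr (r : nat) (Psi : site -> R -> R) (J : R) (L : nat) (i j : site) : R :=
  fine (integral_Lambda J L (fun h => h i * h j * expR (- hamiltonian r L Psi h)))
  / fine (partition_fn r Psi J L).

End Model.

(* Main.v *)
Require Import Defs.
From HB Require Import structures.
From mathcomp Require Import all_boot all_order all_algebra.
From mathcomp Require Import all_classical all_reals all_analysis.
From mathcomp Require Import measurable_realfun zify ring lra.
Import Order.TTheory GRing.Theory Num.Theory.
Import numFieldNormedType.Exports.
Local Open Scope ring_scope.

Set Implicit Arguments.
Unset Strict Implicit.
Unset Printing Implicit Defensive.

(** Let [S] be the cluster (for the range-[r] adjacency) of the site [i] among
the unpinned sites. Since every site around [S] is pinned at [0], flipping the
sign of [h] on [S] preserves the Gibbs weight, so only the event [j \in S]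
contributes to the correlation. Fix a direction [e] with [Psi_e'' >= c]. Along
the chains [v, v + e, v + 2e, ...], which leave [S] at height [0], the energy of
[S] dominates the sum over [v] in [S] of [c/2 (h_v - h_(v+e))^2], while [h_i] and
[h_j] are sums of such gradients. Integrating the sites of [S] in lexicographic
order, the contribution of [S] is thus at most [K^#|S|] times the partition
function with [S] removed, while pinning all of [S] gives [e^(J #|S|)] times the
same quantity; the contribution of [S] is at most [(K e^-J)^#|S|].
The sum over [S] is controlled by counting: at least a fraction [2^(-D #|S|)] of
all subsets of the box have [S] as the cluster of [i], so these fractions sum
to at most [1]; the remaining small factor to the power [#|S|] yields the decay,
as [2r #|S| >= norm1 (j - i)]. *)

(** * Iterated integrals over configurations *)

Section SingleSite.
Context {R : realType} (J : R).
Implicit Types g : R -> \bar R.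
Local Open Scope ereal_scope.

Lemma integral_single_site g : measurable_fun setT g -> (forall x, 0 <= g x) ->
  \int[single_site J]_x g x =
  \int[lebesgue_measure]_x g x + (expR J)%:E * g 0%R.
Proof.
move=> mg g0; rewrite /single_site ge0_integral_measure_add//; congr (_ + _).
rewrite ge0_integral_mscale//; congr (_ * _).
by rewrite integral_dirac// diracT mul1e.
Qed.

Lemma ge0_integral_lebesgueN g : measurable_fun setT g -> (forall x, 0 <= g x) ->
  \int[lebesgue_measure]_x g (- x)%R = \int[lebesgue_measure]_x g x.
Proof.
move=> mg g0.
rewrite -[LHS](@ge0_integral_pushforward _ _ (measurableTypeR R) (measurableTypeR R) R
  (-%R : measurableTypeR R -> measurableTypeR R) _ lebesgue_measure setT g)//.
by apply: eq_measure_integral => A mA _; exact: lebesgue_measureN.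
Qed.

Lemma integral_single_siteN g : measurable_fun setT g -> (forall x, 0 <= g x) ->
  \int[single_site J]_x g (- x)%R = \int[single_site J]_x g x.
Proof.
move=> mg g0; rewrite !integral_single_site//; last first.
  exact: (measurableT_comp mg).
by rewrite oppr0 ge0_integral_lebesgueN.
Qed.

(** The indicator removes the atom at [0], and Lebesgue measure does not see that point. *)
Lemma integral_single_site_neq0 g : measurable_fun setT g -> (forall x, 0 <= g x) ->
  \int[single_site J]_x ((x != 0)%R%:R%:E * g x) = \int[lebesgue_measure]_x g x.
Proof.
move=> mg g0.
have mn : measurable_fun (setT : set (measurableTypeR R))
    (fun x : measurableTypeR R => ((x != 0)%R%:R : R)%:E).
  apply/measurable_EFinP.
  rewrite (_ : (fun _ => _) = \1_(~` [set 0%R])); last first.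
    apply/funext => x; rewrite indicE; congr (_%:R); case: eqP => [->|xn0] /=.
      by rewrite memNset//=; apply.
    by rewrite mem_set.
  by apply/measurable_indicP/measurableC.
have mng : measurable_fun (setT : set (measurableTypeR R))
    (fun x : measurableTypeR R => ((x != 0)%R%:R : R)%:E * g x).
  exact: emeasurable_funM.
rewrite integral_single_site//; last by move=> x; rewrite mule_ge0// lee_fin.
rewrite eqxx/= mul0e mule0 adde0.
rewrite -[LHS](@integral_setD1 _ _ 0%R) /=; last 2 first.
- exact: measurableD.
- exact: measurable_funTS.
rewrite -[RHS](@integral_setD1 _ _ 0%R) /=; last 2 first.
- exact: measurableD.
- exact: measurable_funTS.
apply: eq_integral => x /set_mem[_ /eqP/=] xn0.
by rewrite xn0 mul1e.
Qed.

Lemma integral_single_site_eq0 :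
  \int[single_site J]_x ((x == 0)%R%:R : R)%:E = (expR J)%:E.
Proof.
have E : (fun x : measurableTypeR R => ((x == 0)%R%:R : R)%:E) =
      EFin \o (\1_([set 0%R] : set (measurableTypeR R)) : _ -> R).
  apply/funext => x /=; rewrite indicE; congr (_%:R%:E); case: eqP => [->|xn0] /=.
    by rewrite mem_set.
  by rewrite memNset.
rewrite integral_single_site//; last first.
  have mE : measurable_fun (setT : set (measurableTypeR R))
      (EFin \o (\1_([set 0%R] : set (measurableTypeR R)) : _ -> R)).
    by apply/measurable_EFinP/measurable_indicP.
  by move: mE; rewrite -E.
rewrite {1}E integral_indic// setIT /= eqxx mule1.
by rewrite lebesgue_measure_set1 add0e.
Qed.
End SingleSite.

Section IteratedIntegral.
Context {R : realType} (J : R).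
Implicit Types (h : site -> R) (s t : site) (ss : seq site).
Local Open Scope ereal_scope.

(* Measurability of a functional of the configuration without putting a
   sigma-algebra on [site -> R]: it is tested along measurable families of
   configurations, and [p := upd h s] makes every section measurable. *)
Definition conf_measurable d' (U : measurableType d') (f : (site -> R) -> U) :=
  forall d (T : measurableType d) (p : T -> site -> R),
    (forall s, measurable_fun setT (fun z => p z s : measurableTypeR R)) ->
    measurable_fun setT (fun z => f (p z)).

(** Unlike [iint], the integrand takes extended real values. Tonelli and monotonicity then apply to
    nonnegative functionals with no finiteness condition at the inner stages. *)
Fixpoint iintE ss (f : (site -> R) -> \bar R) h : \bar R :=
  match ss with
  | [::] => f h
  | s :: ss' => \int[single_site J]_x iintE ss' f (upd h s x)
  end.

Implicit Types f g : (site -> R) -> \bar R.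

Lemma upd_same h s x : upd h s x s = x.
Proof. by rewrite /upd eqxx. Qed.

Lemma updC h s t x y : s != t -> upd (upd h s x) t y = upd (upd h t y) s x.
Proof.
move=> st; apply/funext => u; rewrite /upd.
by case: eqP => // ->; rewrite eq_sym (negbTE st).
Qed.

Lemma conf_measurable_upd d' (U : measurableType d') (f : (site -> R) -> U) h s :
  conf_measurable f -> measurable_fun setT (fun x : measurableTypeR R => f (upd h s x)).
Proof.
move=> mf; apply: mf => t; rewrite /upd; case: (t == s) => //.
Qed.

Lemma iintE_ge0 ss f h : (forall h, 0 <= f h) -> 0 <= iintE ss f h.
Proof.
by move=> f0; elim: ss h => //= s ss IH h; exact: integral_ge0.
Qed.

Lemma conf_measurable_iintE ss f : (forall h, 0 <= f h) ->
  conf_measurable f -> conf_measurable (iintE ss f).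
Proof.
move=> f0 mf; elim: ss => //= s ss IH d T p mp.
have mq : measurable_fun setT
    (fun z : T * measurableTypeR R => iintE ss f (upd (p z.1) s z.2)).
  apply: IH => t; rewrite /upd; case: (t == s); first exact: measurable_snd.
  exact: (measurableT_comp (mp t) measurable_fst).
have q0 (z : T * measurableTypeR R) : 0 <= iintE ss f (upd (p z.1) s z.2).
  exact: iintE_ge0.
(* Tonelli handles the Lebesgue part of the single-site measure; the atom contributes an evaluation
   at [0]. *)
rewrite (_ : (fun _ => _) = (fun z => \int[lebesgue_measure]_x
    iintE ss f (upd (p z) s x) + (expR J)%:E * iintE ss f (upd (p z) s 0%R))).
  apply: emeasurable_funD.
    exact: (@measurable_fun_fubini_tonelli_F _ _ T (measurableTypeR R) R
      lebesgue_measure _ mq q0).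
  apply: measurable_funeM; apply: IH => t; rewrite /upd; case: (t == s) => //.
apply/funext => z; rewrite integral_single_site//.
  by apply: conf_measurable_upd.
by move=> x; exact: iintE_ge0.
Qed.

Lemma eq_iintE ss f g h : f =1 g -> iintE ss f h = iintE ss g h.
Proof. by move=> /funext ->. Qed.

Lemma le_iintE ss f g h : (forall h, 0 <= f h) -> conf_measurable f ->
  conf_measurable g -> (forall h, f h <= g h) -> iintE ss f h <= iintE ss g h.
Proof.
move=> f0 mf mg fg; elim: ss h => //= s ss IH h.
have g0 h' : 0 <= g h' by exact: le_trans (f0 h') (fg h').
apply: ge0_le_integral => //=.
- by move=> x _; exact: iintE_ge0.
- by apply: conf_measurable_upd; exact: conf_measurable_iintE.
- by apply: conf_measurable_upd; exact: conf_measurable_iintE.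
Qed.

Lemma iintE_sum (I : Type) (r : seq I) ss (F : I -> (site -> R) -> \bar R) h :
  (forall i h, 0 <= F i h) -> (forall i, conf_measurable (F i)) ->
  iintE ss (fun h => \sum_(i <- r) F i h) h = \sum_(i <- r) iintE ss (F i) h.
Proof.
move=> F0 mF; elim: ss h => //= s ss IH h.
under eq_integral do rewrite IH.
rewrite ge0_integral_sum//.
- by move=> i; apply: conf_measurable_upd; exact: conf_measurable_iintE.
- by move=> i x _; exact: iintE_ge0.
Qed.

Lemma iintE_indep ss f h s x : s \notin ss ->
  (forall h x, f (upd h s x) = f h) -> iintE ss f (upd h s x) = iintE ss f h.
Proof.
elim: ss h => //= t ss IH h; rewrite inE negb_or => /andP[st sss] fs.
by apply: eq_integral => y _; rewrite updC// IH.
Qed.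

Lemma iintEZl ss (w : (site -> R) -> R) f h :
  (forall h, (0 <= w h)%R) -> (forall h, 0 <= f h) -> conf_measurable f ->
  {in ss, forall s h x, w (upd h s x) = w h} ->
  iintE ss (fun h => (w h)%:E * f h) h = (w h)%:E * iintE ss f h.
Proof.
move=> w0 f0 mf; elim: ss h => //= s ss IH h ws.
rewrite -ge0_integralZl_EFin//.
- apply: eq_integral => x _; rewrite IH ?ws ?mem_head//.
  by move=> t tss; apply: ws; rewrite inE tss orbT.
- by move=> x _; exact: iintE_ge0.
- by apply: conf_measurable_upd; exact: conf_measurable_iintE.
Qed.

(* The weight [w a] may involve coordinates integrated outside [a], but none
   integrated inside it; hence the weights integrate out one after the other. *)
Lemma iintE_prod (w : site -> (site -> R) -> R) (B : R) (S : pred site) ss f h :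
  (0 <= B)%R ->
  (forall s h, (0 <= w s h)%R) -> (forall s, conf_measurable (fun h => (w s h)%:E)) ->
  (forall s h, \int[single_site J]_x (w s (upd h s x))%:E = B%:E) ->
  uniq ss ->
  pairwise (fun a b => `[< forall h x, w a (upd h b x) = w a h >]) ss ->
  (forall h, 0 <= f h) -> conf_measurable f ->
  (forall s h x, S s -> f (upd h s x) = f h) ->
  iintE ss (fun h => (\prod_(s <- ss | S s) w s h)%:E * f h) h =
  (B ^+ count S ss)%:E * iintE [seq s <- ss | ~~ S s] f h.
Proof.
move=> B0 w0 mw iw + + f0 mf fS.
have mpw (r : seq site) : conf_measurable (fun h => (\prod_(s <- r | S s) w s h)%:E).
  move=> d T p mp; apply/measurable_EFinP.
  under eq_fun do rewrite -big_filter.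
  apply: measurable_prod => s _.
  by apply/measurable_EFinP; exact: mw.
have pw0 (r : seq site) h' : (0 <= \prod_(s <- r | S s) w s h')%R.
  by apply: prodr_ge0 => s _; exact: w0.
elim: ss h => [|s ss IH] h; first by rewrite /= big_nil mul1e.
move=> /= /andP[sss uss] /andP[ws pws].
have mF r : conf_measurable (fun h => (\prod_(s <- r | S s) w s h)%:E * f h).
  by move=> d T p mp; apply: emeasurable_funM; [exact: mpw|exact: mf].
have F0 r h' : 0 <= (\prod_(s <- r | S s) w s h')%:E * f h'.
  by rewrite mule_ge0// lee_fin.
have nf : s \notin [seq s <- ss | ~~ S s] by rewrite mem_filter (negbTE sss) andbF.
have [Ss|Ss] := boolP (S s); rewrite /= ?add1n ?add0n.
  under eq_integral => x _.
    rewrite (@eq_iintE ss _ (fun h => (w s h)%:E *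
      ((\prod_(s <- ss | S s) w s h)%:E * f h))); last first.
      by move=> h'; rewrite big_cons Ss EFinM muleA.
    rewrite iintEZl//; last first.
      move=> t tss h' y; move/allP : ws => /(_ _ tss)/asboolP; exact.
    rewrite IH// iintE_indep//; last by move=> h' y; rewrite fS.
    rewrite muleC; over.
  rewrite ge0_integralZl//=.
  - rewrite iw exprS EFinM muleC muleA//.
  - exact: (@conf_measurable_upd _ _ (fun h => (w s h)%:E)).
  - by move=> x _; rewrite lee_fin.
  - by rewrite mule_ge0// ?lee_fin ?exprn_ge0// iintE_ge0.
under eq_integral => x _.
  rewrite (@eq_iintE ss _ (fun h => (\prod_(s <- ss | S s) w s h)%:E * f h)).
    rewrite IH//; over.
  by move=> h'; rewrite big_cons (negbTE Ss).
rewrite ge0_integralZl_EFin//.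
- by move=> x _; exact: iintE_ge0.
- by apply: conf_measurable_upd; exact: conf_measurable_iintE.
- exact: exprn_ge0.
Qed.

Definition flip (S : pred site) h : site -> R := fun s => if S s then (- h s)%R else h s.

Lemma conf_measurable_flip d' (U : measurableType d') S (f : (site -> R) -> U) :
  conf_measurable f -> conf_measurable (f \o flip S).
Proof.
move=> mf d T p mp; apply: mf => s; rewrite /flip; case: (S s) => //.
exact: (@measurableT_comp _ _ _ _ _ _ (-%R : measurableTypeR R -> measurableTypeR R)).
Qed.

(** Both parts of the single-site measure are symmetric, so the sign changes one coordinate at a
    time. The coordinates outside [ss] are not integrated, hence the flip of [h] on the right. *)
Lemma iintE_flip S ss f h : (forall h, 0 <= f h) -> conf_measurable f ->
  iintE ss (f \o flip S) h = iintE ss f (flip S h).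
Proof.
move=> f0 mf; elim: ss h => //= s ss IH h.
under eq_integral do rewrite IH.
have [Ss|Ss] := boolP (S s).
  rewrite -integral_single_siteN.
  - apply: eq_integral => x _; congr iintE; apply/funext => t.
    rewrite /flip /upd; case: eqP => [->|//]; by rewrite Ss opprK.
  - have := @conf_measurable_upd _ _ (iintE ss f \o flip S) h s.
    by apply; apply: conf_measurable_flip; exact: conf_measurable_iintE.
  - by move=> x; exact: iintE_ge0.
apply: eq_integral => x _; congr iintE; apply/funext => t.
by rewrite /flip /upd; case: eqP => [->|//]; rewrite (negbTE Ss).
Qed.

(** Linearity has to be used at every stage of the iterated integral. So integrability is required
    of each inner integral, the one over [drop k ss], and for every configuration of the outer
    sites. *)
Lemma iint_funposneg (F : (site -> R) -> R) ss h :
  conf_measurable (fun h => (F h)%:E) ->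
  (forall k h, iintE (drop k ss) (fun h => `|(F h)%:E|) h < +oo) ->
  iint J ss F h = iintE ss (fun h => (Num.max (F h) 0)%:E) h
                - iintE ss (fun h => (Num.max (- F h) 0)%:E) h.
Proof.
move=> mF fin.
have mFp : conf_measurable (fun h => (Num.max (F h) 0)%:E).
  move=> d T p mp; apply/measurable_EFinP; apply: measurable_maxr => //.
  by apply/measurable_EFinP; exact: mF.
have mFn : conf_measurable (fun h => (Num.max (- F h) 0)%:E).
  move=> d T p mp; apply/measurable_EFinP; apply: measurable_maxr => //.
  by apply: measurableT_comp => //; apply/measurable_EFinP; exact: mF.
have mFa : conf_measurable (fun h => `|(F h)%:E|).
  by move=> d T p mp; apply: measurableT_comp => //; exact: mF.
have Fp0 h' : 0 <= (Num.max (F h') 0)%:E by rewrite lee_fin le_max lexx orbT.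
have Fn0 h' : 0 <= (Num.max (- F h') 0)%:E by rewrite lee_fin le_max lexx orbT.
have finp k h' : iintE (drop k ss) (fun h => (Num.max (F h) 0)%:E) h' < +oo.
  apply: le_lt_trans (fin k h'); apply: le_iintE => // h''.
  by rewrite lee_fin ge_max normr_ge0 ler_norm.
have finn k h' : iintE (drop k ss) (fun h => (Num.max (- F h) 0)%:E) h' < +oo.
  apply: le_lt_trans (fin k h'); apply: le_iintE => // h''.
  by rewrite lee_fin ge_max normr_ge0 -normrN ler_norm.
clear fin.
elim: ss h finp finn => [|s ss IH] h finp finn.
  rewrite /= -EFinB; congr EFin.
  by rewrite /Num.max /Order.max; case: ltP => F0; case: ltP => F1; lra.
rewrite /=.
under eq_integral => x _.
  rewrite IH; last 2 first.
  - by move=> k; exact: finp k.+1.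
  - by move=> k; exact: finn k.+1.
  over.
rewrite /= integralB//.
- apply/integrableP; split.
    by apply: conf_measurable_upd; exact: conf_measurable_iintE.
  under eq_integral do rewrite gee0_abs ?iintE_ge0//.
  exact: (finp 0%N).
- apply/integrableP; split.
    by apply: conf_measurable_upd; exact: conf_measurable_iintE.
  under eq_integral do rewrite gee0_abs ?iintE_ge0//.
  exact: (finn 0%N).
Qed.

End IteratedIntegral.

(** * Clusters in a finite graph and in the box *)

Section Cluster.
Context {T : finType} (adj : rel T).
Implicit Types (A B S : {set T}) (i j x y : T).

Definition open_edge A : rel T := [rel x y | [&& x \in A, y \in A & adj x y]].

Definition cluster A i : {set T} := [set x in A | connect (open_edge A) i x].

Lemma cluster_sub A i : cluster A i \subset A.
Proof. by apply/fintype.subsetP => x; rewrite inE => /andP[]. Qed.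

Lemma mem_cluster A i : (i \in cluster A i) = (i \in A).
Proof. by rewrite inE connect0 andbT. Qed.

Lemma cluster_eq0 A i : i \notin A -> cluster A i = finset.set0.
Proof.
move=> iA; apply/setP => x; rewrite !inE; apply/negP => /andP[xA /connectP[[|y p]]].
  by move=> _ /= xi; rewrite -xi xA in iA.
by move=> /= /andP[/andP[iA' _]]; rewrite iA' in iA.
Qed.

Lemma cluster_closed A i x y :
  x \in cluster A i -> y \in A -> adj x y -> y \in cluster A i.
Proof.
rewrite !inE => /andP[xA ix] yA xy; rewrite yA /=.
apply: (connect_trans ix); apply: connect1.
by apply/and3P; split.
Qed.

Lemma path_cluster A i x p : x \in cluster A i -> path (open_edge A) x p ->
  path (open_edge (cluster A i)) x p.
Proof.
elim: p x => //= y p IH x xi /andP[/and3P[xA yA xy] pp].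
have yi := cluster_closed xi yA xy.
by apply/andP; split; [exact/and3P|exact: IH].
Qed.

Lemma path_last_in A x p : x \in A -> path (open_edge A) x p -> last x p \in A.
Proof. by elim: p x => //= y p IH x _ /andP[/and3P[_ yA _]]; exact: IH. Qed.

Lemma cluster_path A i j : j \in cluster A i ->
  exists p, [/\ path (open_edge (cluster A i)) i p, last i p = j & uniq (i :: p)].
Proof.
rewrite inE => /andP[jA /connectP[p pp jp]].
have iA : i \in cluster A i.
  rewrite mem_cluster; case: p pp jp => [|y p] /=; first by move=> _ <-.
  by move=> /andP[/and3P[]].
have {pp} := path_cluster iA pp.
rewrite jp => pp; case/shortenP : pp => q pq uq _ .
by exists q.
Qed.

(** A path in [B] from [i] cannot leave the old cluster. Hence points that are not adjacent to a
    cluster can be added freely without changing it. *)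
Lemma cluster_local A B i : i \in cluster A i -> cluster A i \subset B ->
  (forall x y, x \in cluster A i -> y \in B -> adj x y -> y \in cluster A i) ->
  cluster B i = cluster A i.
Proof.
move=> iA AB Bc; apply/setP => x; apply/idP/idP => [|xA].
  rewrite inE => /andP[_ /connectP[p pp ->]].
  elim: p {1 3 4}i iA pp => //= y p IH z zi /andP[/and3P[_ yB zy]].
  by apply: IH; exact: Bc zy.
have [p [pp <- _]] := cluster_path xA.
rewrite inE (fintype.subsetP AB) ?path_last_in//=; apply/connectP; exists p => //.
apply: sub_path pp => u v /=.
by move=> /and3P[/(fintype.subsetP AB) uB /(fintype.subsetP AB) vB uv]; exact/and3P.
Qed.

(* At least [2 ^ (#|T| - D #|S|)] sets have the same cluster [S], since only the
   points of [S] and their neighbours matter; distinct [S] share no such set. *)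
Lemma sum_clusters_le1 {R : realFieldType} (D : nat) i :
  (forall x, #|[set y | (y == x) || adj x y]| <= D)%N ->
  \sum_(S : {set T} | (i \in S) && [exists A, cluster A i == S])
    (2%:R^-1 : R) ^+ (D * #|S|) <= 1.
Proof.
move=> degD.
have cardS S : (i \in S) && [exists A, cluster A i == S] ->
    (2%:R^-1 : R) ^+ (D * #|S|) * 2%:R ^+ #|T| <= (#|[set A | cluster A i == S]|)%:R.
  move=> /andP[iS /existsP[A /eqP AS]].
  (* [N] is [S] together with its neighbours; every subset of the complement of [N] can be added to
     [S] and leaves the cluster equal to [S]. *)
  pose N := \bigcup_(x in S) [set y | (y == x) || adj x y].
  have SN : S \subset N.
    by apply/fintype.subsetP => x xS; apply/bigcupP; exists x; rewrite // inE eqxx.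
  have cN : (#|N| <= D * #|S|)%N.
    have /leq_trans : (#|N| <= \sum_(x in S) #|[set y | (y == x) || adj x y]|)%N.
      rewrite /N; elim/big_rec2 : _ => [|x m B _ h]; first by rewrite cards0.
      by rewrite (leq_trans (leq_card_setU _ _))// leq_add2l.
    apply; rewrite mulnC -sum_nat_const; exact: leq_sum.
  have img : [set S :|: B | B in powerset (~: N)] \subset [set A | cluster A i == S].
    apply/fintype.subsetP => _ /imsetP[B + ->]; rewrite powersetE => BN; rewrite inE.
    rewrite -AS; apply/eqP/cluster_local.
    - by rewrite AS.
    - exact: finset.subsetUl.
    - move=> x y; rewrite AS => xS; rewrite inE => /orP[//|yB] xy.
      have := fintype.subsetP BN _ yB; rewrite inE => /negP[].
      by apply/bigcupP; exists x => //; rewrite inE xy orbT.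
  have := subset_leq_card img; rewrite card_in_imset; last first.
    move=> B C; rewrite !powersetE => BN CN /setP BC; apply/setP => x.
    have := BC x; rewrite !inE; case: (boolP (x \in S)) => //= xS _.
    have xN : x \in N := fintype.subsetP SN _ xS.
    apply/idP/idP => [/(fintype.subsetP BN)|/(fintype.subsetP CN)]; by rewrite inE xN.
  rewrite card_powerset -(ler_nat R) => /(le_trans _); apply.
  rewrite natrX -(cardsC N) exprD mulrA ler_piMl ?exprn_ge0 ?ler0n//.
  rewrite exprVn mulrC ler_pdivrMr ?exprn_gt0// ?ltr0n// mul1r.
  by rewrite ler_weXn2l// ler1n.
rewrite -(@ler_pM2r _ (2%:R ^+ #|T|)) ?exprn_gt0// ?ltr0n//.
rewrite mulr_suml mul1r.
apply: le_trans (ler_sum _ cardS) _.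
apply: (@le_trans _ _ (\sum_(S : {set T}) (#|[set A | cluster A i == S]|)%:R)).
  rewrite [leRHS](bigID (fun S => (i \in S) && [exists A, cluster A i == S])) /=.
  by rewrite lerDl sumr_ge0.
rewrite -natr_sum -natrX ler_nat -cardsT -card_powerset.
(* Sorting the subsets of [T] by the cluster of [i] counts each of them exactly once. *)
under eq_bigr do rewrite -sum1_card.
rewrite -[leqRHS]sum1_card [leqRHS](partition_big (cluster^~ i) xpredT)//=.
rewrite leq_eqVlt; apply/orP; left; apply/eqP; apply: eq_bigr => S _.
by apply: eq_bigl => A; rewrite inE powersetE finset.subsetT.
Qed.

End Cluster.

(** * Geometry of the box and its lexicographic order *)

Section Box.
Implicit Types (s t u : site).

Lemma mem_irange M a : (a \in irange M) = (`|a| <= M)%N.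
Proof.
apply/mapP/idP => [[k + ->]|aM].
  by rewrite mem_iota; lia.
by exists (absz (a + M%:Z)); rewrite ?mem_iota; lia.
Qed.

Lemma mem_box M s : (s \in box M) = (`|s.1| <= M)%N && (`|s.2| <= M)%N.
Proof.
case: s => a b /=; apply/allpairsP/andP => [[[x y] /= [xM yM [-> ->]]]|[aM bM]].
  by rewrite -!mem_irange.
by exists (a, b); rewrite !mem_irange.
Qed.

Lemma size_box M : size (box M) = ((2 * M).+1 * (2 * M).+1)%N.
Proof. by rewrite size_allpairs !size_map !size_iota. Qed.

Lemma pairwise_irange M : pairwise (fun a b : int => a < b) (irange M).
Proof.
rewrite /irange pairwise_map; move: (2 * M).+1 => N; move: 0%N; elim: N => //= n IH m.
rewrite IH andbT; apply/allP => k; rewrite mem_iota /=; lia.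
Qed.

Lemma pairwise_allpairs (r1 r2 : seq int) :
  pairwise (fun a b => a < b) r1 -> pairwise (fun a b => a < b) r2 ->
  pairwise slt [seq (a, b) | a <- r1, b <- r2].
Proof.
move=> p1 p2; elim: r1 p1 => //= a r1 IH /andP[ar1 /IH {}IH].
rewrite pairwise_cat; apply/and3P; split => //.
  apply/allrelP => _ _ /mapP[b _ ->] /allpairsP[[c d] /= [cr1 _ ->]].
  by rewrite /slt /= (allP ar1 _ cr1).
rewrite pairwise_map; apply: sub_pairwise p2 => b c bc.
by rewrite /slt /= bc eqxx orbT.
Qed.

Lemma pairwise_box M : pairwise slt (box M).
Proof. by apply: pairwise_allpairs; exact: pairwise_irange. Qed.

Lemma slt_irr s : slt s s = false.
Proof. by case: s => a b; rewrite /slt /=; lia. Qed.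

Lemma slt_trans s t u : slt s t -> slt t u -> slt s u.
Proof. case: s t u => [a b] [c d] [e f]; rewrite /slt /=; lia. Qed.

Lemma uniq_box M : uniq (box M).
Proof.
have := pairwise_box M; elim: (box M) => //= s r IH /andP[sr pr].
rewrite IH// andbT; apply/negP => /(allP sr); by rewrite slt_irr.
Qed.

(** Translation by [- x] embeds the neighbourhood of [x] into [box r]. *)
Lemma card_seq_sub_range M (r : nat) (x : seq_sub (box M)) :
  (#|[set y | (y == x) || (normoo (ssub (val y) (val x)) <= r)%N]|
     <= (2 * r).+1 * (2 * r).+1)%N.
Proof.
rewrite -size_box cardE.
rewrite -(size_map (fun y : seq_sub (box M) => ssub (val y) (val x))).
apply: uniq_leq_size.
  rewrite map_inj_uniq ?enum_uniq// => y z; rewrite /ssub => -[] e1 e2.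
  apply/val_inj; rewrite /= [val y]surjective_pairing [val z]surjective_pairing.
  by rewrite (addIr _ e1) (addIr _ e2).
move=> _ /mapP[y + ->]; rewrite mem_enum inE mem_box /normoo geq_max.
case/orP => // /eqP ->; rewrite /ssub /=; lia.
Qed.

Lemma normoo_ssubC s t : normoo (ssub s t) = normoo (ssub t s).
Proof. by rewrite /normoo /ssub /=; lia. Qed.

Lemma slt_sadd s t : slt t (0, 0) -> slt (sadd s t) s.
Proof. by case: s t => [a b] [a' b']; rewrite /slt /=; lia. Qed.

Lemma ssub_sadd s t : ssub (sadd s t) s = t.
Proof. by case: t => a b; rewrite /ssub /=; congr pair; ring. Qed.

Lemma normoo_le_norm1 s : (normoo s <= norm1 s)%N.
Proof. by rewrite /normoo /norm1; lia. Qed.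

End Box.

(** * The Hamiltonian around a cluster *)

Section Potential.
Context {R : realType}.
Implicit Types (f : R -> R) (x m : R).

Lemma C2_continuous f : C2 f -> continuous f.
Proof. by case=> df _ x; apply/differentiable_continuous/derivable1_diffP. Qed.

(** The function [phi], which is [f] minus the parabola, is even and has a nondecreasing derivative,
    so it is smallest at [0]. *)
Lemma even_C2_ge f m x : C2 f -> (forall y, f y = f (- y)) ->
  (forall y, m <= derive1n 2 f y) -> f 0 + m / 2%:R * x ^+ 2 <= f x.
Proof.
move=> [df [ddf _]] fN mf.
wlog x0 : x / 0 < x.
  move=> H; case: (ltgtP x 0) => [x0|/H//|->].
    by rewrite (fN x) -(sqrrN x); apply: H; rewrite oppr_gt0.
  by rewrite expr0n mulr0 addr0.
pose phi y := f y - m / 2%:R * y ^+ 2.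
pose dphi y := derive1 f y - m * y.
pose ddphi y := derive1n 2 f y - m.
have d1 (y : R) : is_derive y (1:R) phi (dphi y).
  have d : is_derive y (1:R) f (derive1 f y).
    by rewrite derive1E; exact: derivableP.
  rewrite /phi; apply: is_derive_eq.
  by rewrite /dphi /GRing.scale /=; field.
have d2 (y : R) : is_derive y (1:R) dphi (ddphi y).
  have d : is_derive y (1:R) (derive1 f) (derive1n 2 f y).
    rewrite -[derive1n 2 f y]/(derive1 (derive1 f) y) [derive1 (derive1 f) y]derive1E.
    exact: derivableP.
  rewrite /dphi; apply: is_derive_eq.
  by rewrite /ddphi /GRing.scale /=; ring.
have c1 : continuous phi.
  by move=> y; apply/differentiable_continuous/derivable1_diffP; case: (d1 y).
have c2 : continuous dphi.
  by move=> y; apply/differentiable_continuous/derivable1_diffP; case: (d2 y).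
(* The mean value theorem on [[0, x]] and on [[-x, 0]], with [phi] even, gives
   [2 (phi x - phi 0) = (dphi a - dphi b) x], and [b < a]. *)
have [a a0 ea] := MVT x0 (fun y _ => d1 y) (continuous_subspaceT c1).
have nx0 : - x < 0 by rewrite oppr_lt0.
have [b b0 eb] := MVT nx0 (fun y _ => d1 y) (continuous_subspaceT c1).
have ba : b < a.
  by move: a0 b0; rewrite !in_itv /= => /andP[a0 _] /andP[_ b0]; exact: lt_trans b0 a0.
have [d _ ed] := MVT ba (fun y _ => d2 y) (continuous_subspaceT c2).
have dd : dphi b <= dphi a.
  by rewrite -subr_ge0 ed mulr_ge0 ?subr_ge0 ?(ltW ba)// /ddphi mf.
have phiN : phi (- x) = phi x by rewrite /phi -fN sqrrN.
rewrite phiN in eb.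
have : 0 <= (dphi a - dphi b) * x by rewrite mulr_ge0 ?(ltW x0)// subr_ge0.
have p0 : phi 0 = f 0 by rewrite /phi expr0n /= mulr0 subr0.
rewrite p0 in ea eb.
have px : phi x = f x - m / 2%:R * x ^+ 2 by [].
rewrite px in ea eb.
nra.
Qed.

End Potential.

(** * A direction of uniform convexity *)

Section Directions.
Context {R : realType} (r : nat) (c : R) (Psi : site -> R -> R).
Implicit Types (k s : site) (x : R).

Definition convex_direction k := forall x, c <= derive1n 2 (Psi k) x.

Lemma reach_nonzero (S : site -> Prop) (x y : site) : reach S x y -> x <> y ->
  exists2 k, S k & k <> (0, 0).
Proof.
elim=> [//|{x y}x y z Sk _ IH xz].
case: (pselect (y = z)) => [yz|/IH//].
exists (ssub y x) => // -[]; move: xz; rewrite -yz.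
case: x y {Sk IH yz} => [a b] [a' b'] /= xy ha hb; apply: xy; congr pair; lia.
Qed.

Hypotheses (c0 : 0 < c) (adm : admissible r c Psi).

Lemma Psi_sopp k : Psi (sopp k) = Psi k.
Proof. by apply/funext => x; case: adm => _ [/(_ k x) ->]. Qed.

Lemma Psi_ge0 k x : Psi k 0 <= Psi k x.
Proof.
have [_ [_ [ev [C2k [pos _]]]]] := adm.
have := @even_C2_ge _ (Psi k) 0 x (C2k k) (ev k) (pos k).
by rewrite !mul0r addr0.
Qed.

Lemma Psi_convex_ge k x : convex_direction k -> Psi k 0 + c / 2%:R * x ^+ 2 <= Psi k x.
Proof. by move=> ck; have [_ [_ [ev [C2k _]]]] := adm; exact: even_C2_ge. Qed.

(** An irreducible walk makes some nonzero jump, and a jump beyond range [r] would have zero second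
    derivative, below [c]. Replacing the jump by its opposite if necessary makes it
    lexicographically negative, so that [v + e] precedes [v] in the enumeration of the box. *)
Lemma exists_convex_direction :
  exists e, [/\ convex_direction e, (norm1 e <= r)%N & slt e (0, 0)].
Proof.
have [far [_ [_ [_ [_ irr]]]]] := adm.
have neq : (0, 0) <> (1, 0) :> site by [].
have [k ck k0] := reach_nonzero (irr (0, 0) (1, 0)) neq.
have kr k' : convex_direction k' -> (norm1 k' <= r)%N.
  move=> ck'; rewrite leqNgt; apply/negP => /far Psi0.
  have : c <= 0.
    apply: le_trans (ck' 0) _.
    have -> : Psi k' = cst 0 by exact/funext.
    have E : derive1 (cst 0 : R -> R) = cst 0.
      by apply/funext => y; rewrite derive1_cst.
    by rewrite -[derive1n 2 _]/(derive1 (derive1 _)) !E.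
  by rewrite leNgt c0.
have [sk|sk] := boolP (slt k (0, 0)).
  by exists k; split => //; exact: kr.
exists (sopp k); have ck' : convex_direction (sopp k).
  by move=> x; rewrite Psi_sopp; exact: ck.
split => //; first exact: kr.
case: k k0 sk {ck ck'} => a b; rewrite /slt /sopp /= => k0 sk.
have : ~~ ((a == 0) && (b == 0)).
  by apply/negP => /andP[/eqP a0 /eqP b0]; apply: k0; rewrite a0 b0.
lia.
Qed.

End Directions.

Section Hamiltonian.
Context {R : realType} (r L : nat) (c : R) (Psi : site -> R -> R) (e : site).
Hypotheses (c0 : 0 < c) (adm : admissible r c Psi)
  (ce : convex_direction c Psi e) (er : (norm1 e <= r)%N) (e0 : slt e (0, 0)).
Implicit Types (h : site -> R) (S : pred site) (v : site).

(** The test imposes the zero boundary condition, whatever [h] is outside the box. *)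
Definition grad h v : R := h v - (if sadd v e \in box L then h (sadd v e) else 0).

Definition zero_on S h : site -> R := fun v => if S v then 0 else h v.

Definition shielded S h := forall a b, a \in box L -> b \in box L -> S a -> ~~ S b ->
  (normoo (ssub b a) <= r)%N -> h b = 0.

(** Each interior pair is charged to its lexicographically larger site. The bond between [v] and
    [v + e] then always belongs to [v], whether it is interior or crosses the boundary. *)
Lemma hamiltonian_sites h : hamiltonian r L Psi h =
  \sum_(v <- box L)
   (\sum_(a <- box L | slt a v && (normoo (ssub v a) <= r)%N) Psi (ssub v a) (h a - h v)
    + \sum_(b <- box (L + r) | (b \notin box L) && (normoo (ssub b v) <= r)%N)
        Psi (ssub b v) (h v)).
Proof. by rewrite big_split /= (exchange_big_dep xpredT). Qed.

Lemma ler_sum_gap (I : eqType) (s : seq I) (P : pred I) (F G : I -> R) (a : I) (q : R) :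
  (forall x, x \in s -> P x -> F x <= G x) -> a \in s -> P a -> F a + q <= G a ->
  \sum_(x <- s | P x) F x + q <= \sum_(x <- s | P x) G x.
Proof.
move=> FG as_ Pa Fq.
rewrite (big_rem _ as_) [leRHS](big_rem _ as_) /= Pa addrAC lerD//.
rewrite big_seq_cond [leRHS]big_seq_cond; apply: ler_sum => x /andP[/mem_rem xs Px].
exact: FG.
Qed.

(** Setting [h] to [0] on [S] brings every bond touching [S] to [Psi 0], its minimum, because the
    other end is either in [S] or already at [0]. At each [v] of [S], the bond in direction [e]
    drops by the quadratic amount as well. *)
Lemma hamiltonian_split S h : shielded S h ->
  hamiltonian r L Psi (zero_on S h)
    + \sum_(v <- box L | S v) c / 2%:R * grad h v ^+ 2 <= hamiltonian r L Psi h.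
Proof.
move=> iso; rewrite !hamiltonian_sites [X in _ + X]big_mkcond -big_split /=.
rewrite big_seq [leRHS]big_seq; apply: ler_sum => v vL.
have edge a : a \in box L -> slt a v && (normoo (ssub v a) <= r)%N ->
    Psi (ssub v a) (zero_on S h a - zero_on S h v) <= Psi (ssub v a) (h a - h v).
  move=> aL /andP[_ neighbor]; rewrite /zero_on.
  have [Sa|Sa] := boolP (S a); have [Sv|Sv] := boolP (S v) => //.
  - by rewrite subr0; exact: Psi_ge0 adm _ _.
  - by rewrite (iso a v)// !subr0; exact: Psi_ge0 adm _ _.
  - by rewrite (iso v a) 1?normoo_ssubC// subr0; exact: Psi_ge0 adm _ _.
have bdry b : b \in box (L + r) -> (b \notin box L) && (normoo (ssub b v) <= r)%N ->
    Psi (ssub b v) (zero_on S h v) <= Psi (ssub b v) (h v).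
  by move=> _ _; rewrite /zero_on; case: ifP => // _; exact: Psi_ge0 adm _ _.
have [Sv|Sv] := boolP (S v); last first.
  rewrite addr0 lerD//.
    by rewrite big_seq_cond [leRHS]big_seq_cond; apply: ler_sum => a /andP[]; exact: edge.
  by rewrite big_seq_cond [leRHS]big_seq_cond; apply: ler_sum => a /andP[]; exact: bdry.
have near_e : (normoo e <= r)%N := leq_trans (normoo_le_norm1 e) er.
have [veL|veL] := boolP (sadd v e \in box L).
  rewrite addrAC lerD//; last first.
    by rewrite big_seq_cond [leRHS]big_seq_cond; apply: ler_sum => a /andP[]; exact: bdry.
  have sve : ssub v (sadd v e) = sopp e.
    by rewrite /ssub /sopp /=; congr pair; ring.
  apply: (ler_sum_gap edge veL); rewrite sve.
    by rewrite slt_sadd//= /normoo /= !abszN.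
  rewrite (Psi_sopp adm).
  have -> : zero_on S h (sadd v e) - zero_on S h v = 0.
    rewrite /zero_on Sv subr0; case: ifP => // /negbT Sve.
    by apply: (iso v) => //; rewrite ssub_sadd.
  rewrite /grad veL -[(h v - _) ^+ 2]sqrrN opprB; exact: (Psi_convex_ge adm).
rewrite -addrA lerD//.
  by rewrite big_seq_cond [leRHS]big_seq_cond; apply: ler_sum => a /andP[]; exact: edge.
apply: (ler_sum_gap bdry (a := sadd v e)).
(* As [e] has range at most [r], a site [v + e] outside the box still lies in the layer summed over
   by the boundary term. *)
- by move: vL; rewrite !mem_box /=; move: near_e; rewrite /normoo; lia.
- by rewrite ssub_sadd near_e andbT.
- by rewrite ssub_sadd /zero_on Sv /grad (negbTE veL) subr0; exact: (Psi_convex_ge adm).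
Qed.

(* Following the direction [e] from a site of [S], one leaves [S] at a site
   where [h] vanishes. *)
Lemma norm_le_sum_grad S h i : shielded S h -> i \in box L -> S i || (h i == 0) ->
  `|h i| <= \sum_(v <- box L | S v) `|grad h v|.
Proof.
move=> iso iL.
case/orP => [Si|/eqP ->]; last by rewrite normr0 sumr_ge0.
(* Induction on prefixes of the sorted box: [v + e] lies in a strictly shorter prefix, so the
   gradient at [v] has not been counted yet. *)
suff : forall p q, box L = p ++ q ->
    {in p, forall v, S v -> `|h v| <= \sum_(v <- p | S v) `|grad h v|}.
  by move=> /(_ (box L) [::]); rewrite cats0; apply.
elim/last_ind => // p v IH q; rewrite cat_rcons => boxE u.
have vL : v \in box L by rewrite boxE mem_cat inE eqxx orbT.
rewrite mem_rcons inE => /orP[/eqP ->{u} Sv|up Su]; last first.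
  rewrite big_rcons /= (le_trans (IH _ boxE _ up Su))//.
  by rewrite lerDl; case: ifP.
rewrite big_rcons /= Sv.
have -> : h v = grad h v + (if sadd v e \in box L then h (sadd v e) else 0).
  by rewrite /grad subrK.
rewrite addrC (le_trans (ler_normD _ _))// lerD//.
case: ifPn => veL; last by rewrite normr0 sumr_ge0.
have [Sve|Sve] := boolP (S (sadd v e)); last first.
  by rewrite (iso v) ?normr0 ?sumr_ge0// ssub_sadd (leq_trans (normoo_le_norm1 e)).
apply: (IH _ boxE) => //.
have sve := slt_sadd v e0.
have := pairwise_box L; rewrite boxE pairwise_cat /= => /and3P[_ _ /andP[vq _]].
move: veL; rewrite boxE mem_cat inE => /or3P[//|/eqP vev|veq].
  by rewrite vev slt_irr in sve.
by have := slt_trans sve (allP vq _ veq); rewrite slt_irr.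
Qed.

(** Half of the energy [c/2 x^2] is kept as the Gaussian; the other half pays for a factor
    [e^(2|x|)] at the cost [4/c], since [2|x| <= 4/c + c/4 x^2]. *)
Definition gauss (x : R) : R := expR (4%:R / c - c / 4%:R * x ^+ 2).

Lemma shielded_weight_le S h i j : shielded S h -> i \in box L -> j \in box L ->
  S i || (h i == 0) -> S j || (h j == 0) ->
  `|h i * h j| * expR (- hamiltonian r L Psi h) <=
  (\prod_(v <- box L | S v) gauss (grad h v)) *
    expR (- hamiltonian r L Psi (zero_on S h)).
Proof.
move=> iso iL jL Si Sj.
have [hi hj] := (norm_le_sum_grad iso iL Si, norm_le_sum_grad iso jL Sj).
set G := \sum_(v <- box L | S v) `|grad h v| in hi hj.
(* Both heights are at most [G], so their product is at most [e^(2G)], which factorizes over the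
   sites of [S]. *)
have Gexp : G <= expR G by rewrite (le_trans _ (expR_ge1Dx _))// lerDr.
have hij : `|h i * h j| <= expR (2%:R * G).
  rewrite normrM mulr_natl mulr2n expRD.
  by apply: ler_pM => //; [apply: le_trans Gexp|apply: le_trans Gexp].
apply: le_trans (ler_wpM2r (expR_ge0 _) hij) _.
have -> : \prod_(v <- box L | S v) gauss (grad h v) =
    expR (\sum_(v <- box L | S v) (4%:R / c - c / 4%:R * grad h v ^+ 2)).
  by rewrite (big_morph expR (@expRD R) (@expR0 R)).
rewrite -!expRD ler_expR.
have := hamiltonian_split iso.
have : 2%:R * G <= \sum_(v <- box L | S v) (4%:R / c - c / 4%:R * grad h v ^+ 2) +
    \sum_(v <- box L | S v) c / 2%:R * grad h v ^+ 2; last by lra.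
rewrite -big_split /= mulr_sumr; apply: ler_sum => v _.
rewrite -subr_ge0 -(real_normK (num_real (grad h v))).
set g := `|grad h v|.
have -> : 4%:R / c - c / 4%:R * g ^+ 2 + c / 2%:R * g ^+ 2 - 2%:R * g =
    c / 4%:R * (g - 4%:R / c) ^+ 2 by field; rewrite gt_eqF.
by rewrite mulr_ge0 ?sqr_ge0 ?divr_ge0 ?(ltW c0).
Qed.

End Hamiltonian.

(** * Random clusters and Gaussian weights *)

Section Gauss.
Context {R : realType} (c : R).
Hypothesis c0 : 0 < c.

(** The Lebesgue integral of [gauss c], a multiple of the normal density of variance [2/c]. This is
    the constant [K] per site. *)
Definition gauss_mass : R := expR (4%:R / c) / normal_peak (Num.sqrt (2%:R / c)).

Let s0 : Num.sqrt (2%:R / c) != 0.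
Proof. by rewrite gt_eqF// sqrtr_gt0 divr_gt0. Qed.

Lemma gauss_mass_gt0 : 0 < gauss_mass.
Proof. by rewrite divr_gt0 ?expR_gt0// normal_peak_gt0. Qed.

Lemma gaussE (x y : R) :
  gauss c (x - y) = gauss_mass * normal_pdf y (Num.sqrt (2%:R / c)) x.
Proof.
rewrite normal_pdfE// /gauss_mass mulrA divfK; last first.
  by rewrite gt_eqF// normal_peak_gt0.
rewrite /normal_fun /gauss expRD; congr (_ * expR _).
rewrite sqr_sqrtr ?divr_ge0 ?(ltW c0)// -mulr_natr.
by field; rewrite gt_eqF.
Qed.

Lemma integral_single_site_gauss (J y : R) :
  (\int[single_site J]_x ((x != 0)%:R * gauss c (x - y))%:E = gauss_mass%:E)%E.
Proof.
under eq_integral do rewrite EFinM.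
rewrite integral_single_site_neq0; last 2 first.
- apply/measurable_EFinP; under eq_fun do rewrite gaussE.
  by apply: measurable_funM => //; exact: measurable_normal_pdf.
- by move=> x; rewrite lee_fin expR_ge0.
under eq_integral do rewrite gaussE EFinM.
rewrite ge0_integralZl_EFin//.
- by rewrite integral_normal_pdf mule1.
- by move=> x _; rewrite lee_fin normal_pdf_ge0.
- by apply/measurable_EFinP; exact: measurable_normal_pdf.
- exact: ltW gauss_mass_gt0.
Qed.

End Gauss.

Section Support.
Context {R : realType} (r L : nat).
Implicit Types (h : site -> R) (S : {set seq_sub (box L)}).
Local Notation T := (seq_sub (box L)).

Definition neighbor : rel T := [rel x y | (normoo (ssub (val y) (val x)) <= r)%N].

Definition unpinned h : {set T} := [set v | h (val v) != 0].

(** Clusters are counted in the finite type of box sites, whereas energies and integrals use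
    predicates on all sites. *)
Definition sites S : pred site := [pred s | s \in [seq val v | v in S]].

Lemma sites_val S (v : T) : sites S (val v) = (v \in S).
Proof.
apply/mapP/idP => [[u + /val_inj ->]|vS]; first by rewrite mem_enum.
by exists v; rewrite ?mem_enum.
Qed.

Lemma mem_boxP s : s \in box L -> exists v : T, val v = s.
Proof. by move=> sL; exists (SeqSub sL). Qed.

Lemma count_sites S : count (sites S) (box L) = #|S|.
Proof.
rewrite cardE -(size_map val) -size_filter; apply/perm_size/uniq_perm.
- exact/filter_uniq/uniq_box.
- by rewrite map_inj_uniq ?enum_uniq//; exact: val_inj.
move=> s; rewrite mem_filter /= andb_idr// => /mapP[v _ ->].
exact: valP.
Qed.

(** An unpinned site within range of the cluster would belong to it. *)
Lemma shielded_cluster h (i : T) : shielded r L (sites (cluster neighbor (unpinned h) i)) h.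
Proof.
move=> _ _ /mem_boxP[a <-] /mem_boxP[b <-]; rewrite !sites_val => ai bi ab.
apply/eqP; apply: contraNT bi => hb.
by apply: (cluster_closed ai) => //; rewrite inE.
Qed.

Lemma shielded_unpinned h : shielded r L (sites (unpinned h)) h.
Proof.
move=> _ _ /mem_boxP[a <-] /mem_boxP[b <-]; rewrite !sites_val => _ + _.
by rewrite inE negbK => /eqP.
Qed.

Lemma unpinned_flip S h : unpinned (flip (sites S) h) = unpinned h.
Proof.
by apply/setP => v; rewrite !inE /flip; case: ifP => // _; rewrite oppr_eq0.
Qed.

Lemma norm1_path (x : T) p : path neighbor x p ->
  (norm1 (ssub (val (last x p)) (val x)) <= 2 * r * size p)%N.
Proof.
elim: p x => [|y p IH] x /=; first by rewrite /norm1 /ssub /= !subrr.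
move=> /andP[xy /IH]; move: xy; rewrite /neighbor /= /normoo geq_max /norm1 /ssub /=.
move: (val x) (val y) (val (last y p)) => [a1 a2] [b1 b2] [d1 d2] /=; nia.
Qed.

Lemma path_neighbor_sub A x p : path (open_edge neighbor A) x p -> {subset p <= A}.
Proof.
elim: p x => //= y p IH x /andP[/and3P[_ yA _] /IH pA] z.
by rewrite inE => /predU1P[->//|/pA].
Qed.

(** A simple path inside the cluster has fewer steps than the cluster has sites. Adjacency bounds
    each coordinate of a step by [r], hence the factor [2 * r]. *)
Lemma norm1_cluster A (i j : T) : j \in cluster neighbor A i ->
  (norm1 (ssub (val j) (val i)) <= 2 * r * #|cluster neighbor A i|)%N.
Proof.
move=> jA; have iA : i \in cluster neighbor A i.
  rewrite mem_cluster; apply: contraTT jA => /(cluster_eq0 neighbor) ->.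
  by rewrite inE.
have [p [pp <- up]] := cluster_path jA.
have pn : path neighbor i p by apply: sub_path pp => x y /and3P[].
apply: leq_trans (norm1_path pn) _; rewrite leq_mul2l; apply/orP; right.
apply: ltnW; rewrite cardE -[X in (X <= _)%N]/(size (i :: p)).
apply: uniq_leq_size => // x; rewrite mem_enum inE => /predU1P[->//|].
exact: path_neighbor_sub pp _.
Qed.

Local Open Scope ereal_scope.

Lemma conf_measurable_EFin (f : (site -> R) -> R) :
  conf_measurable f -> conf_measurable (fun h => (f h)%:E).
Proof. by move=> mf d U p mp; apply/measurable_EFinP; exact: mf. Qed.

Lemma conf_measurable_neq0 s : conf_measurable (fun h => (h s != 0)%R%:R : R)%R.
Proof.
move=> d U p mp.
have m1 : measurable_fun (setT : set (measurableTypeR R))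
    (\1_(~` [set 0%R]) : measurableTypeR R -> R).
  by apply/measurable_indicP/measurableC.
rewrite (_ : (fun _ => _) = (\1_(~` [set 0%R]) : measurableTypeR R -> R) \o (p^~ s)).
  exact: measurableT_comp.
apply/funext => z /=; rewrite indicE; congr (_%:R); case: eqP => [->|xn0] /=.
  by rewrite memNset//=; apply.
by rewrite mem_set.
Qed.

Lemma conf_measurable_unpinned (phi : {set T} -> R) :
  conf_measurable (fun h => phi (unpinned h)).
Proof.
(* The unpinned set takes finitely many values; each product is the indicator that it equals [A]. *)
have E h : phi (unpinned h) = (\sum_(A : {set T}) phi A *
    \prod_(v : T) (if v \in A then (h (val v) != 0)%:R else 1 - (h (val v) != 0)%:R))%R.
  rewrite (bigD1 (unpinned h)) //= [X in (_ * X)%R]big1 => [|v _]; last first.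
    by rewrite inE; case: ifPn => [->//|/negbTE ->]; rewrite subr0.
  rewrite mulr1 big1 ?addr0// => A /eqP AS.
  suff [v Av] : exists v, (v \in A) != (h (val v) != 0)%R.
    rewrite (bigD1 v)//= [X in (_ * (X * _))%R](_ : _ = 0)%R ?mul0r ?mulr0//.
    by move: Av; case: (v \in A); case: (h (val v) != 0)%R => //=; rewrite ?subrr.
  apply/existsP; rewrite -negb_forall; apply/negP => /forallP AE; apply: AS.
  by apply/setP => v; rewrite inE; apply/eqP.
move=> d U p mp; under eq_fun do rewrite E.
apply: measurable_sum => A; apply: measurable_funM => //.
apply: measurable_prod => v _; case: (v \in A).
  exact: (@conf_measurable_neq0 (val v)).
by apply: measurable_funB => //; exact: (@conf_measurable_neq0 (val v)).
Qed.

End Support.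

(** * Integrating the weights of a cluster *)

Section Weights.
Context {R : realType} (r L : nat) (c J : R) (Psi : site -> R -> R) (e : site).
Hypotheses (c0 : 0 < c) (adm : admissible r c Psi)
  (ce : convex_direction c Psi e) (er : (norm1 e <= r)%N) (e0 : slt e (0, 0)).
Implicit Types (h : site -> R) (s v : site) (S : {set seq_sub (box L)}).
Local Notation T := (seq_sub (box L)).
Local Notation H := (hamiltonian r L Psi).
Local Notation K := (gauss_mass c).

Lemma hamiltonian_eq h h' : {in box L, h =1 h'} -> H h = H h'.
Proof.
move=> hh; rewrite /hamiltonian; congr (_ + _); apply: eq_big_seq => a aL.
  by rewrite big_seq_cond [RHS]big_seq_cond; apply: eq_bigr => b /andP[bL _]; rewrite !hh.
by apply: eq_bigr => b _; rewrite hh.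
Qed.

(** A bond inside the flipped set has its argument negated. So has a bond leaving it, since its
    other end is at [0], and the potentials are even. *)
Lemma hamiltonian_flip (P : pred site) h : shielded r L P h -> H (flip P h) = H h.
Proof.
have [_ [_ [ev _]]] := adm.
move=> iso; rewrite /hamiltonian; congr (_ + _); apply: eq_big_seq => a aL.
  rewrite big_seq_cond [RHS]big_seq_cond; apply: eq_bigr => b /and3P[bL _ ab].
  rewrite /flip; have [Pa|Pa] := boolP (P a); have [Pb|Pb] := boolP (P b) => //.
  - by rewrite -opprD -ev.
  - by rewrite (iso a b)// !subr0 -ev.
  - have -> : h a = 0 by apply: (iso b a) => //; rewrite normoo_ssubC.
    by rewrite !sub0r opprK -ev.
by apply: eq_bigr => b _; rewrite /flip; case: (P a) => //; rewrite -ev.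
Qed.

Lemma conf_measurable_Psi k (f : (site -> R) -> R) :
  conf_measurable f -> conf_measurable (fun h => Psi k (f h)).
Proof.
move=> mf d U p mp; have [_ [_ [_ [C2k _]]]] := adm.
apply: (@measurableT_comp _ _ _ _ _ _ (Psi k)); last exact: mf.
exact: continuous_measurable_fun (C2_continuous (C2k k)).
Qed.

Lemma conf_measurable_hamiltonian : conf_measurable (H : _ -> R).
Proof.
move=> d U p mp; apply: measurable_funD; apply: measurable_sum => a.
  under eq_fun do rewrite -big_filter; apply: measurable_sum => b.
  apply: (@conf_measurable_Psi _ (fun h => h a - h b)) => // d' U' p' mp'.
  by apply: measurable_funB; exact: mp'.
under eq_fun do rewrite -big_filter; apply: measurable_sum => b.
by apply: (@conf_measurable_Psi _ (fun h => h a)) => // d' U' p' mp'; exact: mp'.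
Qed.

Lemma conf_measurable_expRN (f : (site -> R) -> R) :
  conf_measurable f -> conf_measurable (fun h => expR (- f h)).
Proof.
move=> mf d U p mp; apply: measurableT_comp => //.
by apply: measurableT_comp => //; exact: mf.
Qed.

Lemma conf_measurable_zero_on (P : pred site) (f : (site -> R) -> R) :
  conf_measurable f -> conf_measurable (fun h => f (zero_on P h)).
Proof.
move=> mf d U p mp; apply: mf => s; rewrite /zero_on; case: (P s) => //.
Qed.

Lemma conf_measurable_grad v : conf_measurable (fun h => grad L e h v : R).
Proof.
move=> d U p mp; rewrite /grad; apply: measurable_funB; first exact: mp.
by case: (sadd v e \in box L) => //; exact: mp.
Qed.

Lemma conf_measurable_gauss v : conf_measurable (fun h => gauss c (grad L e h v)).
Proof.
move=> d U p mp; rewrite /gauss; apply: measurableT_comp => //; apply: measurable_funB => //.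
apply: measurable_funM => //; apply: measurable_funX.
exact: (@conf_measurable_grad v _ _ _ mp).
Qed.

(** The indicator discards the atom, so that integrating the site [v] gives exactly [K], without a
    contribution from [e^J]. *)
Definition gauss_weight v h : R := (h v != 0)%:R * gauss c (grad L e h v).

Definition pin_weight v h : R := 1 - (h v != 0)%:R.

Lemma gauss_weight_ge0 v h : 0 <= gauss_weight v h.
Proof. by rewrite mulr_ge0// expR_ge0. Qed.

Lemma pin_weight_ge0 v h : 0 <= pin_weight v h.
Proof. by rewrite /pin_weight; case: (h v != 0); rewrite ?subrr// subr0. Qed.

Lemma conf_measurable_gauss_weight v : conf_measurable (gauss_weight v).
Proof.
move=> d U p mp; apply: measurable_funM; first exact: (@conf_measurable_neq0 R v _ _ _ mp).
exact: (@conf_measurable_gauss v _ _ _ mp).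
Qed.

Lemma conf_measurable_pin_weight v : conf_measurable (pin_weight v).
Proof.
by move=> d U p mp; apply: measurable_funB => //; exact: (@conf_measurable_neq0 R v _ _ _ mp).
Qed.

Lemma upd_other h s x v : v != s -> upd h s x v = h v.
Proof. by rewrite /upd => /negbTE ->. Qed.

Lemma slt_neq s v : slt s v -> s != v.
Proof. by apply: contraTneq => ->; rewrite slt_irr. Qed.

Lemma integral_gauss_weight v h :
  (\int[single_site J]_x (gauss_weight v (upd h v x))%:E = K%:E)%E.
Proof.
pose y := if sadd v e \in box L then h (sadd v e) else 0.
rewrite -(integral_single_site_gauss c0 J y); apply: eq_integral => x _.
by rewrite /gauss_weight /grad upd_same upd_other// slt_neq// slt_sadd.
Qed.

Lemma integral_pin_weight v h :
  (\int[single_site J]_x (pin_weight v (upd h v x))%:E = (expR J)%:E)%E.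
Proof.
rewrite -integral_single_site_eq0; apply: eq_integral => x _.
by rewrite /pin_weight upd_same; case: (x == 0); rewrite /= ?subr0 ?subrr.
Qed.

(** The weight reads only [s] and [s + e], both strictly before [v]. This is the triangular
    structure asked for by [iintE_prod]. *)
Lemma gauss_weight_upd s v h x : slt s v -> gauss_weight s (upd h v x) = gauss_weight s h.
Proof.
move=> sv; rewrite /gauss_weight /grad !upd_other ?slt_neq//.
exact: slt_trans (slt_sadd s e0) sv.
Qed.

Lemma pin_weight_upd s v h x : slt s v -> pin_weight s (upd h v x) = pin_weight s h.
Proof. by move=> sv; rewrite /pin_weight upd_other ?slt_neq. Qed.

Definition boltzmann_weight h : R := expR (- H h).

Lemma conf_measurable_boltzmann : conf_measurable boltzmann_weight.
Proof. exact: conf_measurable_expRN conf_measurable_hamiltonian. Qed.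

Lemma conf_measurable_prod (w : site -> (site -> R) -> R) (P : pred site) (s : seq site) :
  (forall v, conf_measurable (w v)) ->
  conf_measurable (fun h => \prod_(v <- s | P v) w v h).
Proof.
move=> mw d U p mp; under eq_fun do rewrite -big_filter.
by apply: measurable_prod => v _; exact: mw.
Qed.

Lemma conf_measurableM (f g : (site -> R) -> R) :
  conf_measurable f -> conf_measurable g -> conf_measurable (fun h => f h * g h).
Proof. by move=> mf mg d U p mp; apply: measurable_funM; [exact: mf|exact: mg]. Qed.

Let Phi S h : \bar R := (boltzmann_weight (zero_on (sites S) h))%:E.

Let Phi_upd S s h (x : R) : sites S s -> Phi S (upd h s x) = Phi S h.
Proof.
move=> Ss; congr (boltzmann_weight _)%:E; apply/funext => v; rewrite /zero_on /upd.
by case: eqP => // ->; rewrite Ss.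
Qed.

Let mPhi S : conf_measurable (Phi S).
Proof.
apply: conf_measurable_EFin.
exact: (@conf_measurable_zero_on (sites S) _ conf_measurable_boltzmann).
Qed.

Lemma iintE_gauss_weight S h :
  (iintE J (box L) (fun h => (\prod_(v <- box L | sites S v) gauss_weight v h)%:E * Phi S h) h
   = (K ^+ #|S|)%:E * iintE J [seq s <- box L | ~~ sites S s] (Phi S) h)%E.
Proof.
rewrite -count_sites; apply: iintE_prod => //.
- exact: ltW (gauss_mass_gt0 c0).
- by move=> s h'; exact: gauss_weight_ge0.
- by move=> s; exact/conf_measurable_EFin/conf_measurable_gauss_weight.
- by move=> s h'; exact: integral_gauss_weight.
- exact: uniq_box.
- apply: sub_pairwise (pairwise_box L) => a b ab; apply/asboolP => h' x.
  exact: gauss_weight_upd.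
- by move=> h'; rewrite lee_fin expR_ge0.
- by move=> s h' x; exact: Phi_upd.
Qed.

Lemma iintE_pin_weight S h :
  (iintE J (box L) (fun h => (\prod_(v <- box L | sites S v) pin_weight v h)%:E * Phi S h) h
   = (expR J ^+ #|S|)%:E * iintE J [seq s <- box L | ~~ sites S s] (Phi S) h)%E.
Proof.
rewrite -count_sites; apply: iintE_prod => //.
- by move=> s h'; exact: pin_weight_ge0.
- by move=> s; exact/conf_measurable_EFin/conf_measurable_pin_weight.
- by move=> s h'; exact: integral_pin_weight.
- exact: uniq_box.
- apply: sub_pairwise (pairwise_box L) => a b ab; apply/asboolP => h' x.
  exact: pin_weight_upd.
- by move=> h'; rewrite lee_fin expR_ge0.
- by move=> s h' x; exact: Phi_upd.
Qed.

(* Trading the free cluster [S] for the same sites pinned at height [0] costs a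
   factor [K] and gains a factor [e^J] per site. *)
Lemma iintE_cluster_le S (G : (site -> R) -> R) h :
  conf_measurable G -> (forall h, 0 <= G h) ->
  (forall h, G h <= (\prod_(v <- box L | sites S v) gauss_weight v h)
                    * boltzmann_weight (zero_on (sites S) h)) ->
  (iintE J (box L) (fun h => (G h)%:E) h <=
   ((K / expR J) ^+ #|S|)%:E * iintE J (box L) (fun h => (boltzmann_weight h)%:E) h)%E.
Proof.
move=> mG G0 Gle.
set X := iintE J [seq s <- box L | ~~ sites S s] (Phi S) h.
have X0 : (0 <= X)%E by apply: iintE_ge0 => h'; rewrite lee_fin expR_ge0.
have up : (iintE J (box L) (fun h => (G h)%:E) h <= (K ^+ #|S|)%:E * X)%E.
  rewrite -iintE_gauss_weight; apply: le_iintE.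
  - by move=> h'; rewrite lee_fin.
  - exact: conf_measurable_EFin.
  - move=> d U p mp; apply: emeasurable_funM; last exact: mPhi.
    apply/measurable_EFinP.
    exact: (@conf_measurable_prod _ (sites S) _ conf_measurable_gauss_weight _ _ _ mp).
  - by move=> h'; rewrite -EFinM lee_fin.
have lo : ((expR J ^+ #|S|)%:E * X <= iintE J (box L) (fun h => (boltzmann_weight h)%:E) h)%E.
  rewrite -iintE_pin_weight; apply: le_iintE.
  - move=> h'; rewrite -EFinM lee_fin mulr_ge0 ?expR_ge0//.
    by apply: prodr_ge0 => v _; exact: pin_weight_ge0.
  - move=> d U p mp; apply: emeasurable_funM; last exact: mPhi.
    apply/measurable_EFinP.
    exact: (@conf_measurable_prod _ (sites S) _ conf_measurable_pin_weight _ _ _ mp).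
  - exact/conf_measurable_EFin/conf_measurable_boltzmann.
  - move=> h'; rewrite -EFinM lee_fin.
    (* Either all of [S] is pinned, and zeroing it changes nothing, or the product of the pin
       weights vanishes. *)
    have [/allP pin|/allPn[s]] := boolP (all (fun s => sites S s ==> (h' s == 0)) (box L)).
      rewrite big_seq_cond big1 ?mul1r => [|s /andP[sL Ss]]; last first.
        by have := pin _ sL; rewrite Ss /= /pin_weight => ->; rewrite subr0.
      rewrite /boltzmann_weight (@hamiltonian_eq (zero_on (sites S) h') h')// => s sL.
      by rewrite /zero_on; case: ifP => // Ss; have := pin _ sL; rewrite Ss => /eqP.
    move=> sL; rewrite negb_imply => /andP[Ss hs].
    have p0 : pin_weight s h' = 0 by rewrite /pin_weight hs subrr.
    have -> : \prod_(v <- box L | sites S v) pin_weight v h' = 0.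
      by rewrite (big_rem _ sL) [X in if X then _ else _]Ss p0 /= mul0r.
    rewrite mul0r.
    exact: expR_ge0.
apply: le_trans up _.
have -> : ((K / expR J) ^+ #|S|)%:E = ((K ^+ #|S|)%:E * ((expR J ^+ #|S|)^-1)%:E)%E.
  by rewrite -EFinM expr_div_n.
rewrite -[leRHS]muleA; apply: lee_wpmul2l.
  by rewrite lee_fin exprn_ge0// ltW// gauss_mass_gt0.
by rewrite lee_pdivlMl ?exprn_gt0 ?expR_gt0.
Qed.

(** Equal to the Gaussian at an unpinned site and to [1] at a pinned one; it integrates to
    [K + e^J]. *)
Definition full_weight v h : R := gauss_weight v h + pin_weight v h.

(** The energy bound is applied to the set of all unpinned sites; zeroing it leaves the zero
    configuration on the box. *)
Lemma abs_le_full_weight i j h : i \in box L -> j \in box L ->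
  `|h i * h j * boltzmann_weight h| <=
  (\prod_(v <- box L) full_weight v h) * boltzmann_weight (fun=> 0).
Proof.
move=> iL jL; rewrite normrM (ger0_norm (expR_ge0 _)).
have SP k : k \in box L -> sites (unpinned L h) k || (h k == 0).
  move=> /mem_boxP[v <-]; rewrite sites_val inE; exact: orNb.
have := shielded_weight_le c0 adm ce er e0 (@shielded_unpinned R r L h) iL jL
  (SP _ iL) (SP _ jL).
rewrite (@hamiltonian_eq (zero_on _ h) (fun=> 0)) => [|k kL]; last first.
  by rewrite /zero_on; move: (SP _ kL); case: (sites _ k) => //= /eqP.
congr (_ <= _ * _); rewrite big_mkcond; apply: eq_big_seq => v /mem_boxP[u <-].
rewrite sites_val inE /full_weight /gauss_weight /pin_weight.
by case: (h (val u) != 0); rewrite ?mul1r ?subrr ?addr0 ?mul0r ?subr0 ?add0r.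
Qed.

(** This supplies the integrability at every stage that [iint_funposneg] needs. *)
Lemma iintE_abs_fin i j k h : i \in box L -> j \in box L ->
  (iintE J (drop k (box L)) (fun h => `|(h i * h j * boltzmann_weight h)%:E|) h < +oo)%E.
Proof.
move=> iL jL; set ss := drop k (box L).
have [order pss] : allrel slt (take k (box L)) ss /\ pairwise slt ss.
  by have := pairwise_box L; rewrite -{1}(cat_take_drop k (box L)) pairwise_cat => /and3P[].
have uss : uniq ss by exact/drop_uniq/uniq_box.
(* The factors of the sites fixed before stage [k] do not read the later, integrated sites. *)
pose pre h := \prod_(v <- take k (box L)) full_weight v h * boltzmann_weight (fun=> 0).
have w0 v h' : 0 <= full_weight v h'.
  by rewrite addr_ge0 ?gauss_weight_ge0 ?pin_weight_ge0.
have mw v : conf_measurable (full_weight v).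
  move=> d U p mp; apply: measurable_funD.
    exact: (@conf_measurable_gauss_weight v _ _ _ mp).
  exact: (@conf_measurable_pin_weight v _ _ _ mp).
have mpre : conf_measurable pre.
  by apply: conf_measurableM; [exact: conf_measurable_prod|move=> ? *; exact: measurable_cst].
have pre0 h' : 0 <= pre h'.
  by rewrite mulr_ge0 ?expR_ge0// prodr_ge0.
have wupd a b h' x : slt a b -> full_weight a (upd h' b x) = full_weight a h'.
  by move=> ab; rewrite /full_weight gauss_weight_upd// pin_weight_upd.
apply: (@le_lt_trans _ _ (iintE J ss (fun h =>
    (\prod_(v <- ss | v \in ss) full_weight v h)%:E * (pre h)%:E)%E h)).
  apply: le_iintE => //.
  - move=> d U p mp; apply: measurableT_comp => //; apply/measurable_EFinP.
    apply: measurable_funM; last exact: (conf_measurable_boltzmann mp).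
    by apply: measurable_funM; exact: mp.
  - move=> d U p mp; apply/measurable_EFinP; apply: measurable_funM; last exact: mpre.
    exact: (@conf_measurable_prod _ (mem ss) _ mw _ _ _ mp).
  - move=> h'; rewrite /= -EFinM lee_fin (le_trans (abs_le_full_weight _ iL jL))//.
    rewrite /pre mulrA -big_seq -{1}(cat_take_drop k (box L)) big_cat /=.
    by rewrite [X in X * _]mulrC.
rewrite (@iintE_prod _ _ _ (K + expR J) (mem ss))//.
- rewrite (_ : [seq s <- ss | _] = [::]) /=.
    by rewrite -EFinM ltry.
  by apply/eqP; rewrite -[_ == _]negbK -has_filter; apply/hasPn => s sss; rewrite negbK.
- by rewrite addr_ge0 ?expR_ge0 ?(ltW (gauss_mass_gt0 c0)).
- by move=> v; exact: conf_measurable_EFin.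
- move=> v h'; under eq_integral do rewrite EFinD.
  rewrite ge0_integralD//=.
  + by rewrite integral_gauss_weight integral_pin_weight.
  + by move=> x _; rewrite lee_fin gauss_weight_ge0.
  + apply: (@conf_measurable_upd _ _ _ (fun h => (gauss_weight v h)%:E)).
    exact/conf_measurable_EFin/conf_measurable_gauss_weight.
  + by move=> x _; rewrite lee_fin pin_weight_ge0.
  + apply: (@conf_measurable_upd _ _ _ (fun h => (pin_weight v h)%:E)).
    exact/conf_measurable_EFin/conf_measurable_pin_weight.
- by apply: sub_pairwise pss => a b ab; apply/asboolP => h' x; exact: wupd.
- exact: conf_measurable_EFin.
- move=> s h' x sss; congr ((_ * _)%:E); apply: eq_big_seq => v vk.
  by apply: wupd; exact: (allrelP order).
Qed.

End Weights.

(** * Summing over clusters *)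

Lemma iint_iintE (R : realType) (J : R) ss (f : (site -> R) -> R) h :
  iint J ss f h = iintE J ss (fun h => (f h)%:E) h.
Proof. by elim: ss h => //= s ss IH h; apply: eq_integral => x _; exact: IH. Qed.

Section Correlation.
Context {R : realType} (r L : nat) (c J : R) (Psi : site -> R -> R) (e : site).
Hypotheses (c0 : 0 < c) (adm : admissible r c Psi)
  (ce : convex_direction c Psi e) (er : (norm1 e <= r)%N) (e0 : slt e (0, 0)).
Variables (i j : seq_sub (box L)).
Implicit Types (h : site -> R) (S A : {set seq_sub (box L)}).
Local Notation T := (seq_sub (box L)).
Local Notation H := (hamiltonian r L Psi).
Local Notation boltzmann := (boltzmann_weight r L Psi).

Let F h : R := h (val i) * h (val j) * boltzmann h.

Let is_cluster S h : R := (cluster (@neighbor r L) (unpinned L h) i == S)%:R.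

Let mF : conf_measurable F.
Proof.
move=> d U p mp; apply: measurable_funM; last exact: (conf_measurable_boltzmann L adm mp).
by apply: measurable_funM; exact: mp.
Qed.

Let mcl S : conf_measurable (is_cluster S).
Proof.
exact: (@conf_measurable_unpinned R L (fun A => (cluster (@neighbor r L) A i == S)%:R)).
Qed.

Let mpart (f : R -> R) S : measurable_fun setT f ->
  conf_measurable (fun h => f (F h) * is_cluster S h).
Proof.
move=> mf; apply: (@conf_measurableM R (fun h => f (F h))) => //.
by move=> d U p mp; apply: (measurableT_comp mf); exact: mF.
Qed.

Let pos_part (x : R) : R := Num.max x 0.
Let neg_part (x : R) : R := Num.max (- x) 0.

Let mpos : measurable_fun setT pos_part.
Proof. by apply: measurable_maxr. Qed.

Let mneg : measurable_fun setT neg_part.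
Proof. by apply: measurable_maxr => //; exact: measurable_funN. Qed.

Let pos_ge0 x : 0 <= pos_part x. Proof. by rewrite le_max lexx orbT. Qed.
Let neg_ge0 x : 0 <= neg_part x. Proof. by rewrite le_max lexx orbT. Qed.

Let cl_ge0 S h : 0 <= is_cluster S h. Proof. by rewrite /is_cluster. Qed.

(** Only attainable clusters are kept, as [sum_clusters_le1] counts no other sets; those missing [j]
    cancel by the sign flip. *)
Definition weight_bound S : R :=
  if [&& i \in S, j \in S & [exists A, cluster (@neighbor r L) A i == S]]
  then (gauss_mass c / expR J) ^+ #|S| else 0.

Let Z := iintE J (box L) (fun h => (boltzmann h)%:E) (fun=> 0%R).

Let Z_ge0 : (0 <= Z)%E.
Proof. by apply: iintE_ge0 => h; rewrite lee_fin expR_ge0. Qed.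

Lemma weight_bound_ge0 S : 0 <= weight_bound S.
Proof.
rewrite /weight_bound; case: ifP => // _.
by rewrite exprn_ge0// divr_ge0 ?expR_ge0 ?(ltW (gauss_mass_gt0 c0)).
Qed.

(* Flipping the sign of the cluster of [i] exchanges the positive and negative
   parts of [h i * h j] when [j] is outside the cluster. *)
Let part_le S :
  (iintE J (box L) (fun h => (pos_part (F h) * is_cluster S h)%:E) (fun=> 0%R)
   <= (weight_bound S)%:E * Z
      + iintE J (box L) (fun h => (neg_part (F h) * is_cluster S h)%:E) (fun=> 0%R))%E.
Proof.
have n0 h : (0 <= (neg_part (F h) * is_cluster S h)%:E)%E.
  by rewrite lee_fin mulr_ge0.
rewrite /weight_bound; case: ifPn => [/and3P[iS jS _]|bad].
  apply: (@le_trans _ _ (((gauss_mass c / expR J) ^+ #|S|)%:E * Z)%E); last first.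
    by rewrite leeDl//; exact: iintE_ge0.
  apply: (@iintE_cluster_le R r L c J Psi e c0 adm e0 S
    (fun h => pos_part (F h) * is_cluster S h)).
  - exact: mpart.
  - by move=> h; rewrite mulr_ge0.
  move=> h; rewrite /is_cluster; case: eqP => [clS|_]; last first.
    rewrite mulr0 mulr_ge0 ?expR_ge0//.
    by apply: prodr_ge0 => v _; exact: gauss_weight_ge0.
  rewrite mulr1.
  have iso : shielded r L (sites S) h by rewrite -clS; exact: shielded_cluster.
  have sup v : v \in S -> h (val v) != 0.
    by rewrite -clS => /(fintype.subsetP (cluster_sub _ _ _)); rewrite inE.
  have := shielded_weight_le c0 adm ce er e0 iso (valP i) (valP j).
  rewrite !sites_val iS jS => /(_ isT isT) W.
  apply: le_trans (le_trans W _).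
    rewrite ge_max mulr_ge0 ?expR_ge0// andbT.
    by apply: le_trans (ler_norm _) _; rewrite normrM (ger0_norm (expR_ge0 _)).
  rewrite le_eqVlt; apply/orP; left; apply/eqP; congr (_ * _).
  rewrite big_seq_cond [RHS]big_seq_cond; apply: eq_bigr => _ /andP[/mem_boxP[v <-]].
  by rewrite sites_val /gauss_weight => /sup ->; rewrite mul1r.
rewrite mul0e add0e.
have [iS|iS] := boolP (i \in S); last first.
  (* If the cluster of [i] misses [i], then [i] is pinned and [F] vanishes. *)
  rewrite le_eqVlt; apply/orP; left; apply/eqP/eq_iintE => h.
  rewrite /is_cluster; case: eqP => [clS|_]; last by rewrite !mulr0.
  have : i \notin unpinned L h by rewrite -(mem_cluster (@neighbor r L)) clS.
  by rewrite /F inE negbK => /eqP ->; rewrite !mul0r /pos_part /neg_part oppr0.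
(* The outer configuration is zero, hence invariant under the flip, and [iintE_flip] acts on the
   integrand alone. *)
have -> : (fun=> 0%R : R) = flip (sites S) (fun=> 0%R).
  by apply/funext => s; rewrite /flip oppr0 if_same.
rewrite -(@iintE_flip _ _ _ _ (fun h => (neg_part (F h) * is_cluster S h)%:E))//; last first.
  exact/conf_measurable_EFin/mpart.
have -> : flip (sites S) (fun=> 0%R) = (fun=> 0%R : R).
  by apply/funext => s; rewrite /flip oppr0 if_same.
rewrite le_eqVlt; apply/orP; left; apply/eqP/eq_iintE => h /=.
rewrite /is_cluster unpinned_flip.
case: eqP => [clS|_]; last by rewrite !mulr0.
congr (_ * _)%:E; rewrite /neg_part /pos_part; congr Num.max.
have jS : j \notin S.
  apply: contra bad => jS; rewrite iS jS /=; apply/existsP.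
  by exists (unpinned L h); exact/eqP.
have iso : shielded r L (sites S) h by rewrite -clS; exact: shielded_cluster.
rewrite /F /boltzmann_weight (hamiltonian_flip adm iso) /flip !sites_val iS (negbTE jS).
by rewrite !mulNr opprK.
Qed.

Let sum_is_cluster h : \sum_(S : {set T}) is_cluster S h = 1.
Proof.
rewrite (bigD1 (cluster (@neighbor r L) (unpinned L h) i)) //= /is_cluster eqxx big1 ?addr0//.
by move=> S; rewrite eq_sym => /negbTE ->.
Qed.

Let iintE_parts (f : R -> R) : measurable_fun setT f -> (forall x, 0 <= f x) ->
  (iintE J (box L) (fun h => (f (F h))%:E) (fun=> 0%R) =
   \sum_(S : {set T}) iintE J (box L) (fun h => (f (F h) * is_cluster S h)%:E) (fun=> 0%R))%E.
Proof.
move=> mf f0; rewrite -iintE_sum.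
- apply: eq_iintE => h; rewrite sumEFin; congr EFin.
  by rewrite -mulr_sumr sum_is_cluster mulr1.
- by move=> S h; rewrite lee_fin mulr_ge0.
- by move=> S; exact/conf_measurable_EFin/mpart.
Qed.

(** Summing [part_le] over the clusters gives [A <= b Z + B] for the integrals [A], [B] of the
    positive and negative parts; both being finite, the numerator [A - B] is at most [b Z]. *)
Lemma corr_le_sum_clusters :
  corr r Psi J L (val i) (val j) <= \sum_(S : {set T}) weight_bound S.
Proof.
set b := \sum_(S : {set T}) weight_bound S.
have b0 : 0 <= b by apply: sumr_ge0 => S _; exact: weight_bound_ge0.
have fin k h : (iintE J (drop k (box L)) (fun h => `|(F h)%:E|) h < +oo)%E.
  exact: (iintE_abs_fin J c0 adm ce er e0 k h (valP i) (valP j)).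
rewrite /corr /partition_fn /integral_Lambda [X in _ / fine X]iint_iintE -/Z.
rewrite (@iint_funposneg _ _ F)//; last exact: conf_measurable_EFin.
set A := iintE _ _ _ _; set B := iintE _ _ _ _.
have A0 : (0 <= A)%E by apply: iintE_ge0 => h; rewrite lee_fin le_max lexx orbT.
have B0 : (0 <= B)%E by apply: iintE_ge0 => h; rewrite lee_fin le_max lexx orbT.
have mabs : conf_measurable (fun h => `|(F h)%:E|%E).
  by move=> d U p mp; apply: measurableT_comp => //; apply/measurable_EFinP; exact: mF.
have fA : A \is a fin_num.
  rewrite ge0_fin_numE//; apply: le_lt_trans (fin 0%N (fun=> 0%R)); rewrite drop0.
  apply: le_iintE => //.
  - by move=> h; rewrite lee_fin le_max lexx orbT.
  - by move=> d U p mp; apply/measurable_EFinP; apply: (measurableT_comp mpos); exact: mF.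
  - by move=> h; rewrite lee_fin ge_max normr_ge0 ler_norm.
have fB : B \is a fin_num.
  rewrite ge0_fin_numE//; apply: le_lt_trans (fin 0%N (fun=> 0%R)); rewrite drop0.
  apply: le_iintE => //.
  - by move=> h; rewrite lee_fin le_max lexx orbT.
  - by move=> d U p mp; apply/measurable_EFinP; apply: (measurableT_comp mneg); exact: mF.
  - by move=> h; rewrite lee_fin ge_max normr_ge0 -normrN ler_norm.
have AB : (A <= b%:E * Z + B)%E.
  rewrite /A /B (iintE_parts mpos pos_ge0) (iintE_parts mneg neg_ge0).
  rewrite /b -sumEFin ge0_sume_distrl; last by move=> S _; rewrite lee_fin weight_bound_ge0.
  by rewrite -big_split /=; apply: lee_sum => S _; exact: part_le.
(* If [Z] is infinite, [fine] sends it to [0] and the quotient is [0] by convention; the case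
   [Z = 0] below is the same. *)
have [Zoo|Zfin] := eqVneq Z +oo%E; first by rewrite Zoo /= invr0 mulr0.
have fZ : Z \is a fin_num by rewrite ge0_fin_numE// lt_neqAle Zfin leey.
move: AB Z_ge0; rewrite -(fineK fA) -(fineK fB) -(fineK fZ) -EFinM -EFinD -EFinB.
rewrite !lee_fin /= => AB z0.
have [->|zn0] := eqVneq (fine Z) 0; first by rewrite invr0 mulr0.
by rewrite ler_pdivrMr ?lt_neqAle 1?eq_sym ?zn0// lerBlDr.
Qed.

(** The factor per site splits into [2^(-D)], which makes the sum over clusters at most [1], and
    [e^(-1)], which gives the decay because a cluster joining [i] to [j] has at least
    [norm1 (j - i) / (2r)] sites. *)
Lemma sum_weight_bound_le : (0 < r)%N ->
  gauss_mass c / expR J <= 2%:R^-1 ^+ ((2 * r).+1 * (2 * r).+1) * expR (-1) ->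
  \sum_(S : {set T}) weight_bound S <=
  expR (- ((2 * r)%:R^-1 * (norm1 (ssub (val j) (val i)))%:R)).
Proof.
move=> r0 eps; set D := ((2 * r).+1 * (2 * r).+1)%N in eps *.
set E := expR _; have E0 : 0 <= E by exact: expR_ge0.
apply: (@le_trans _ _ (\sum_(S : {set T} | (i \in S) &&
    [exists A, cluster (@neighbor r L) A i == S]) (2%:R^-1 : R) ^+ (D * #|S|) * E)); last first.
  rewrite -mulr_suml ler_piMl//; apply: sum_clusters_le1 => x.
  exact: card_seq_sub_range.
rewrite [leRHS]big_mkcond; apply: ler_sum => S _; rewrite /weight_bound.
case: ifP => [/and3P[iS jS ex]|_]; last first.
  by case: ifP => // _; rewrite mulr_ge0// exprn_ge0// invr_ge0.
rewrite iS ex /=.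
apply: (@le_trans _ _ ((2%:R^-1 ^+ D * expR (-1)) ^+ #|S|)).
  apply: lerXn2r => //; rewrite nnegrE.
    by rewrite divr_ge0 ?expR_ge0 ?(ltW (gauss_mass_gt0 c0)).
  by rewrite mulr_ge0 ?expR_ge0// exprn_ge0// invr_ge0.
rewrite exprMn -exprM ler_wpM2l ?exprn_ge0 ?invr_ge0//.
rewrite -expRM_natl ler_expR mulrN1 lerN2.
move/existsP : ex => [A /eqP AS].
have := @norm1_cluster r L A i j; rewrite AS => /(_ jS).
rewrite -(ler_nat R) natrM => nS.
by rewrite mulrC ler_pdivrMr ?ltr0n ?muln_gt0// mulrC.
Qed.

End Correlation.

Unset Implicit Arguments.

Theorem theorem2p8 (R : realType) (r : nat) (c : R) :
  (1 <= r)%N -> 0 < c ->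
  exists C8 : R -> R,
  forall Psi : site -> R -> R, admissible r c Psi ->
  exists J0 : R,
  forall J : R, J0 <= J ->
    0 < C8 J /\
    forall (L : nat) (i j : site), inLambda L i -> inLambda L j ->
      corr r Psi J L i j <= (C8 J)^-1 * expR (- C8 J * (norm1 (ssub j i))%:R).
Proof.
move=> r1 c0.
(* The rate is the reciprocal of the distance [2r] gained per cluster site, the same for all [J]. *)
exists (fun=> (2 * r)%:R^-1) => Psi adm.
have [e [ce er e0]] := exists_convex_direction c0 adm.
set q : R := 2%:R^-1 ^+ ((2 * r).+1 * (2 * r).+1) * expR (-1).
have q0 : 0 < q by rewrite mulr_gt0 ?expR_gt0// exprn_gt0// invr_gt0.
have K0 := gauss_mass_gt0 c0.
(* This is the value of [J] at which [K e^(-J)] equals [q]. *)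
exists (ln (gauss_mass c / q)) => J J0.
have eps : gauss_mass c / expR J <= q.
  rewrite ler_pdivrMr ?expR_gt0// mulrC -ler_pdivrMr//.
  by rewrite -[leLHS]lnK ?ler_expR// posrE divr_gt0.
split=> [|L i j [i1 i2] [j1 j2]]; first by rewrite invr_gt0 ltr0n muln_gt0.
have iL : i \in box L by rewrite mem_box i1 i2.
have jL : j \in box L by rewrite mem_box j1 j2.
have := corr_le_sum_clusters J c0 adm ce er e0 (SeqSub iL) (SeqSub jL).
move=> /le_trans; apply.
apply: le_trans (sum_weight_bound_le c0 (SeqSub iL) (SeqSub jL) r1 eps) _.
(* The prefactor [1 / C8] is [2r], which is at least [1]. *)
rewrite invrK /= mulNr ler_peMl ?expR_ge0// ler1n muln_gt0 /=.
exact: r1.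
Qed.
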